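(* Let $(X,X^+)$ be an ordered Banach space whose positive cone $X^+$ is generating and normal, and let $T \in \mathcal{L}(X)$ be positive. Then the following assertions are equivalent: (i) $\operatorname{r}(T) < 1$, where $\operatorname{r}(T)$ denotes the spectral radius of $T$. (ii) The operator $\mathrm{id} - T : X \to X$ is bijective and its inverse $(\mathrm{id}-T)^{-1}$ is positive. (iii) (Monotone bounded invertibility property) There exists a number $c \ge 0$ such that for all $x,y \in X^+$, $(\mathrm{id}-T)x \le y$ implies $\|x\| \le c\|y\|$. (iv) (Uniform small-gain condition) There is a number $\eta > 0$ such that $\operatorname{dist}\big((T-\mathrm{id})x, X^+\big) \ge \eta \|x\|$ for each $x \in X^+$. (v) (Robust small-gain condition) There exists $\varepsilon > 0$ such that $(T+P)x \not\ge x$ for every $0 \neq x \in X^+$ and every positive operator $P \in \mathcal{L}(X)$ with $\|P\| \le \varepsilon$. (vi) (Rank-1 robust small-gain condition) There exists $\varepsilon > 0$ such that $(T+P)x \not\ge x$ for every $0 \neq x \in X^+$ and every positive operator $P \in \mathcal{L}(X)$ of rank $1$ with $\|P\| \le \varepsilon$.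
   Context: An ordered Banach space $(X,X^+)$ is a real Banach space $X$ together with a non-empty closed set $X^+\subseteq X$ such that $\alpha X^+ + \beta X^+ \subseteq X^+$ for all $\alpha,\beta\ge 0$ and $X^+\cap(-X^+)=\{0\}$; it induces the partial order $x\le y \iff y-x\in X^+$, and $x\not\ge y$ means $x-y\notin X^+$. The cone is generating if $X^+ - X^+ = X$, and normal if there is $C>0$ with $\|x\|\le C\|y\|$ whenever $0\le x\le y$. A linear operator $A$ is positive if $AX^+\subseteq X^+$. $\operatorname{dist}(x,S)=\inf\{\|x-y\|: y\in S\}$. Spectral notions (spectrum, spectral radius) of an operator on a real Banach space are those of its unique bounded extension to a complexification of $X$. $\mathcal{L}(X)$ is the space of bounded linear operators on $X$ and $\mathrm{id}$ the identity. *)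

(* Defs.v *)
From HB Require Import structures.
From mathcomp Require Import all_boot all_order all_algebra.
From mathcomp Require Import all_classical all_reals all_analysis.
Set Implicit Arguments. Unset Strict Implicit. Unset Printing Implicit Defensive.
Import Order.TTheory GRing.Theory Num.Theory.
Import numFieldNormedType.Exports.
Local Open Scope classical_set_scope.
Local Open Scope ring_scope.

Definition is_cone (R : realType) (X : completeNormedModType R) (K : set X) :=
  [/\ K !=set0, closed K,
      (forall a b x y, 0 <= a -> 0 <= b -> K x -> K y -> K (a *: x + b *: y))
    & (forall x, K x -> K (- x) -> x = 0)].

Definition cone_le (R : realType) (X : completeNormedModType R) (K : set X)
  (x y : X) := K (y - x).

Definition generating (R : realType) (X : completeNormedModType R) (K : set X) :=
  forall x : X, exists a b, K a /\ K b /\ x = a - b.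

Definition normal_cone (R : realType) (X : completeNormedModType R) (K : set X) :=
  exists C : R, 0 < C /\
    forall x y : X, cone_le K 0 x -> cone_le K x y -> `|x| <= C * `|y|.

Definition positive_op (R : realType) (X : completeNormedModType R) (K : set X)
  (A : X -> X) := forall x, K x -> K (A x).

Definition opnorm_le (R : realType) (X : completeNormedModType R)
  (A : X -> X) (e : R) := forall x, `|A x| <= e * `|x|.

Definition rank_one (R : realType) (X : completeNormedModType R) (A : X -> X) :=
  (exists x, A x != 0) /\ exists v : X, forall x, exists a : R, A x = a *: v.

Definition dist_set (R : realType) (X : completeNormedModType R) (x : X)
  (S : set X) : R := inf [set `|x - y| | y in S].

(* Spectrum via the complexification X_C = X x X, with
   T_C (x + i y) = T x + i T y and lambda = a + i b:
   (T_C - lambda)(x, y) = (T x - a x + b y, T y - b x - a y).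
   lambda is in the spectrum iff this operator is not bijective
   (bounded inverse is automatic by the open mapping theorem). *)
Definition complexified_shift (R : realType) (X : completeNormedModType R)
  (T : X -> X) (a b : R) : X * X -> X * X :=
  fun p => (T p.1 - a *: p.1 + b *: p.2, T p.2 - b *: p.1 - a *: p.2).

Definition spectrum (R : realType) (X : completeNormedModType R) (T : X -> X)
  : set (R * R) :=
  [set ab | ~ bijective (complexified_shift T ab.1 ab.2)].

Definition spectral_radius (R : realType) (X : completeNormedModType R)
  (T : X -> X) : R :=
  sup [set Num.sqrt (ab.1 ^+ 2 + ab.2 ^+ 2) | ab in spectrum T].

(* Main.v *)
Require Import Defs.
From HB Require Import structures.
From mathcomp Require Import all_boot all_order all_algebra.
From mathcomp Require Import all_classical all_reals all_analysis.
From mathcomp Require Import ring lra.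
Import Order.TTheory GRing.Theory Num.Theory.
Import numFieldNormedType.Exports.
Local Open Scope classical_set_scope.
Local Open Scope ring_scope.

Set Implicit Arguments.
Unset Strict Implicit.
Unset Printing Implicit Defensive.

(* The implications are proved along (i) => (ii) => (iii) => (iv) => (v) => (vi)
   => (iii) => (ii) => (i).
   - If [id - mu T] has a positive inverse of norm at most [B], a Neumann series
     gives a positive inverse of [id - (mu + d) T] for [d >= 0] with
     [d B |T| < 1]. As long as [B] stays locally bounded, one can therefore
     continue from [mu = 0] to [mu = 1]. Under (i) the bound near each [mu] comes
     from the bounded inverse theorem, under (iii) from (iii) itself.
   - Under (ii) the same step leads to some [mu > 1] with positive inverse [h] of
     [id - mu T]; then [mu^n T^n x <= h x] for [x] in [K], so that normality makes
     [T^n] decay like [mu^-n] and the Neumann series on the complexification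
     excludes spectrum of modulus larger than [mu^-1]. No Gelfand formula is used.
   - For (vi) => (iii), Hahn-Banach and normality provide a positive functional
     [phi] of norm at most 1 with [|x| <= N phi(x)], and
     [P = phi(x)^-1 phi y] is the perturbation that contradicts (vi). *)

(** * Geometric series, Zabreiko's lemma and the bounded inverse theorem *)

Lemma geometric_series_cvg (R : realType) (X : completeNormedModType R)
    (u : nat -> X) (C q : R) :
  0 <= q -> q < 1 -> (forall n, `|u n| <= C * q ^+ n) ->
  exists2 l, series u @ \oo --> l & `|l| <= C / (1 - q).
Proof.
move=> q0 q1 uC.
have C0 : 0 <= C by have := uC 0%N; rewrite expr0 mulr1; apply: le_trans.
have gC : series (geometric C q) @ \oo --> C / (1 - q).
  by apply: cvg_geometric_series; rewrite ger0_norm.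
have nu : cvgn [normed series u].
  apply: (@series_le_cvg _ (fun n => `|u n|) (geometric C q)) => //=.
  - by move=> n; rewrite mulr_ge0 // exprn_ge0.
  - exact: cvgP gC.
exists (limn (series u)); first exact: normed_cvg.
apply: (le_trans (lim_series_norm nu)).
rewrite -(cvg_lim (@Rhausdorff R) gC).
by apply: lim_series_le => //; exact: cvgP gC.
Qed.

Lemma geometric_half_series_cvg (R : realType) (X : completeNormedModType R)
    (u : nat -> X) (C : R) :
  (forall n, `|u n| <= C / 2 ^+ n) ->
  exists2 l, series u @ \oo --> l & `|l| <= 2 * C.
Proof.
move=> uC; have -> : 2 * C = C / (1 - 2^-1) by field.
apply: geometric_series_cvg => [||n]; [lra | lra | by rewrite exprVn].
Qed.

Lemma continuous_linear_bound (R : realType) (V W : normedModType R)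
    (f : {linear V -> W}) : continuous f ->
  exists2 t : R, 0 < t & forall x, `|f x| <= t * `|x|.
Proof.
move=> cf; have /linear_boundedP := @continuous_linear_bounded _ _ _ 0 f (cf 0).
by move=> /pinfty_ex_gt0 [t t0 ft]; exists t.
Qed.

Lemma linear_bound_continuous (R : realType) (V W : normedModType R)
    (f : {linear V -> W}) (t : R) : (forall x, `|f x| <= t * `|x|) ->
  continuous f.
Proof.
move=> ft; apply: bounded_linear_continuous; apply/linear_boundedP.
exists t; split; first exact: num_real.
by move=> r /ltW tr x; apply: le_trans (ft x) _; rewrite ler_wpM2r.
Qed.

(* Zabreiko's lemma; [P r x] reads "the seminorm of [x] is at most [r]", and the
   last hypothesis is its countable subadditivity along dyadic series. *)
Lemma zabreiko (R : realType) (X : completeNormedModType R) (P : R -> set X) :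
  (forall x, exists r, P r x) ->
  (forall r s x, r <= s -> P r x -> P s x) ->
  (forall r s x y, P r x -> P s y -> P (r + s) (x + y)) ->
  (forall r a x, P r x -> P (`|a| * r) (a *: x)) ->
  (forall C u x, (forall n, P (C / 2 ^+ n) (u n)) ->
    series u @ \oo --> x -> P (2 * C) x) ->
  exists2 M : R, 0 < M & forall x, P (M * `|x|) x.
Proof.
move=> Pex Pmono PD PZ Pser.
(* The sets [P n] cover the space, so by Baire's theorem the closure of one of them contains a
   ball. *)
have [n [x0 [r [r0 Br]]]] : exists n x0 (r : R), 0 < r /\
    ball x0 r `<=` closure (P n%:R).
  apply: contrapT => nex.
  have : dense (\bigcap_i (~` closure (P i%:R))).
    apply: Baire => i; split; first exact/closed_openC/closed_closure.
    apply: contrapT => /denseNE [U [[x /open_nbhs_nbhs/nbhs_ballP[e e0 xe]] U0]].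
    apply: nex; exists i, x, e; split => // z /xe Uz.
    apply: contrapT => zP; have : (U `&` ~` closure (P i%:R)) z by [].
    by rewrite U0.
  have -> : \bigcap_i ~` closure (P i%:R) = set0.
    rewrite -subset0 => x xP; have [r Pr] := Pex x.
    apply: (xP (Num.truncn r).+1 Logic.I).
    apply: subset_closure; apply: Pmono Pr.
    by apply/ltW; rewrite -truncn_le_nat.
  exact: dense0.
(* The ball is recentred at 0: [z] is half the difference of [x0 + z] and [x0 - z], and both points
   are approximated from [P n]. *)
have approx0 z (e : R) : `|z| < r -> 0 < e -> exists2 y, P n%:R y & `|z - y| < e.
  move=> zr e0.
  have near_pt w : `|w| < r -> exists2 y, P n%:R y & `|x0 + w - y| < e.
    move=> wr; have /Br : ball x0 r (x0 + w).
      by rewrite -ball_normE /ball_/= opprD addNKr normrN.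
    move=> /(_ _ (nbhsx_ballx _ _ e0)) [y [Py]].
    by rewrite -ball_normE /ball_/= => ?; exists y.
  have [y1 Py1 y1e] := near_pt z zr.
  have [|y2 Py2 y2e] := near_pt (- z); first by rewrite normrN.
  exists (2^-1 *: (y1 + -1 *: y2)).
    have := PZ _ 2^-1 _ (PD _ _ _ _ Py1 (PZ _ (-1) _ Py2)).
    apply: Pmono; rewrite normrN1 mul1r ger0_norm //; lra.
  have -> : z - 2^-1 *: (y1 + -1 *: y2) =
      2^-1 *: ((x0 + z - y1) - (x0 - z - y2)).
    have {1}-> : z = 2^-1 *: (z + z).
      by rewrite -mulr2n -[z *+ 2]scaler_nat scalerA mulVf ?scale1r // pnatr_eq0.
    rewrite -scalerBr; congr (_ *: _); rewrite scaleN1r !opprD !opprK.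
    by rewrite [RHS]addrACA [x0 + z + _]addrACA subrr add0r.
  rewrite normrZ ger0_norm //.
  have := ler_normB (x0 + z - y1) (x0 - z - y2); lra.
have P00 : P 0 0.
  by have [s Ps] := Pex 0; have := PZ _ 0 _ Ps; rewrite normr0 mul0r scaler0.
(* Scaling [z] to norm [r / 2] costs the factor [2 n / r]; the summand 1 keeps [N] positive when
   [n = 0]. *)
pose N := 2 * n%:R / r + 1.
have N0 : 0 < N by rewrite /N ltr_wpDl // divr_ge0 ?mulr_ge0 // ltW.
have approx z (e : R) : 0 < e -> exists2 y, P (N * `|z|) y & `|z - y| < e.
  move=> e0; have [->|z0] := eqVneq z 0.
    by exists 0; rewrite ?subrr normr0 // mulr0.
  have nz0 : 0 < `|z| by rewrite normr_gt0.
  pose a := r / 2 / `|z|; have a0 : 0 < a by rewrite /a !divr_gt0.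
  have [||y Py ye] := approx0 (a *: z) (a * e); last 1 first.
  - exists (a^-1 *: y).
      apply: Pmono (PZ _ a^-1 _ Py); rewrite gtr0_norm ?invr_gt0 // /N /a.
      have -> : (r / 2 / `|z|)^-1 * n%:R = 2 * n%:R / r * `|z|.
        by field; rewrite !gt_eqF.
      by rewrite ler_wpM2r // lerDl.
    rewrite -(ltr_pM2l a0) -[X in X * `|_|](gtr0_norm a0) -normrZ scalerBr.
    by rewrite scalerA mulfV ?gt_eqF // scale1r.
  - rewrite normrZ gtr0_norm // /a divfK ?gt_eqF //; lra.
  - exact: mulr_gt0.
exists (2 * N); first by rewrite mulr_gt0.
move=> x; have [->|x0n] := eqVneq x 0; first by rewrite normr0 mulr0.
have nx0 : 0 < `|x| by rewrite normr_gt0.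
(* [h] approximates the remainder at stage [k] with an error that halves at each stage, so the
   approximants satisfy the dyadic bound of the last hypothesis. *)
have /(@choice _ _ _)[h hP] : forall zk : X * nat, exists y,
    P (N * `|zk.1|) y /\ `|zk.1 - y| < `|x| / 2 ^+ zk.2.+1.
  move=> [z k] /=.
  by have [|y ? ?] := approx z (`|x| / 2 ^+ k.+1); [rewrite divr_gt0 | exists y].
(* [rest k] is what remains of [x] after subtracting the first [k] terms. *)
pose rest := fix rest k :=
  if k is k'.+1 then rest k' - h (rest k', k') else x.
have rest_le k : `|rest k| <= `|x| / 2 ^+ k.
  case: k => [|k] /=; first by rewrite expr0 divr1.
  by have [_ /= /ltW] := hP (rest k, k).
rewrite -mulrA; apply: (Pser _ (fun k => h (rest k, k))).
  move=> k; have [+ _] := hP (rest k, k); apply: Pmono.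
  by rewrite /= -mulrA ler_wpM2l // ltW.
have serE k : series (fun k => h (rest k, k)) k = x - rest k.
  elim: k => [|k IH]; first by rewrite /series /= big_geq // subrr.
  by rewrite seriesSr IH /= opprB addrA addrAC.
have -> : series (fun k => h (rest k, k)) = (fun k => x - rest k).
  by apply/funext => k; exact: serE.
rewrite -[X in _ --> X]subr0; apply: cvgB; first exact: cvg_cst.
apply/cvgr0Pnorm_le => e e0.
have : geometric `|x| (2^-1 : R) @ \oo --> 0.
  by apply: cvg_geometric; rewrite ger0_norm //; lra.
move=> /cvgr0Pnorm_le/(_ e e0); apply: filterS => k.
apply: le_trans; rewrite ger0_norm /= ?mulr_ge0 ?exprn_ge0 //.
by rewrite exprVn; exact: rest_le.
Qed.

Lemma cvg_linear_series (R : realType) (V W : normedModType R)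
    (f : {linear V -> W}) (u : nat -> V) (l : V) : continuous f ->
  series u @ \oo --> l -> series (f \o u) @ \oo --> f l.
Proof.
move=> cf ul; have -> : series (f \o u) = f \o series u.
  by apply/funext => n; rewrite /series /= linear_sum.
by apply: (@cvg_comp _ _ _ _ _ _ _ _ ul); exact: cf.
Qed.

(** Zabreiko's lemma applies to the seminorm [|g x|]: if the terms [g (u n)] are dyadically bounded,
    they sum to some [z], and continuity of [F] gives [F z = x]. *)
Lemma bounded_inverse (R : realType) (X : completeNormedModType R)
    (F : {linear X -> X}) (g : X -> X) :
  continuous F -> cancel F g -> cancel g F ->
  exists2 B : R, 0 < B & forall x, `|g x| <= B * `|x|.
Proof.
move=> cF Fg gF; have lg := can2_linear Fg gF.
pose gl : {linear X -> X} := HB.pack g (GRing.isLinear.Build _ _ _ _ _ lg).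
apply: (zabreiko (P := fun r => [set x | `|g x| <= r])) => /=.
- by move=> x; exists `|g x|.
- by move=> r s x rs /le_trans; apply.
- move=> r s x y xr ys; have -> : g (x + y) = g x + g y by exact: (linearD gl).
  exact: le_trans (ler_normD _ _) (lerD xr ys).
- move=> r a x xr; have -> : g (a *: x) = a *: g x by exact: (linearZZ gl).
  by rewrite normrZ ler_wpM2l.
- move=> C u x uC ux.
  have [z uz zC] := geometric_half_series_cvg (u := g \o u) uC.
  suff <- : F z = x by rewrite Fg.
  have := cvg_linear_series cF uz.
  have -> : F \o (g \o u) = u by apply/funext => n /=.
  by move=> uFz; exact: (cvg_unique _ uFz ux).
Qed.

(** * Cones: closure properties, bounded decompositions and positive Neumann series *)

Section cone.
Variables (R : realType) (X : completeNormedModType R) (K : set X).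
Hypothesis coneK : is_cone K.

Lemma coneZD a b x y : 0 <= a -> 0 <= b -> K x -> K y -> K (a *: x + b *: y).
Proof. by case: coneK => _ _ + _; apply. Qed.

Lemma cone0 : K 0.
Proof.
have [[x Kx] _ _ _] := coneK.
by have := coneZD (lexx 0) (lexx 0) Kx Kx; rewrite !scale0r addr0.
Qed.

Lemma coneD x y : K x -> K y -> K (x + y).
Proof. by move=> Kx Ky; have := coneZD ler01 ler01 Kx Ky; rewrite !scale1r. Qed.

Lemma coneZ a x : 0 <= a -> K x -> K (a *: x).
Proof.
by move=> a0 Kx; have := coneZD a0 ler01 Kx cone0; rewrite scaler0 addr0.
Qed.

Lemma cone_series (u : nat -> X) l :
  (forall n, K (u n)) -> series u @ \oo --> l -> K l.
Proof.
move=> Ku; apply: closed_cvg; first by case: coneK.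
near=> n; rewrite /series /=; apply: (big_ind K) => //; first exact: cone0.
exact: coneD.
Unshelve. all: by end_near. Qed.

(** Zabreiko's lemma for the infimum of [max |a| |b|] over all decompositions [x = a - b]. Dyadic
    series of the two parts converge separately, and their sums stay in [K] because [K] is
    closed. *)
Lemma generating_bound : generating K -> exists2 M : R, 0 < M &
  forall x, exists a b, [/\ K a, K b, x = a - b,
    `|a| <= M * `|x| & `|b| <= M * `|x|].
Proof.
move=> genK; apply: (zabreiko (P := fun r => [set x | exists a b,
  [/\ K a, K b, x = a - b, `|a| <= r & `|b| <= r]])) => /=.
- move=> x; have [a [b [Ka [Kb ->]]]] := genK x.
  by exists (Num.max `|a| `|b|), a, b; split; rewrite // le_max lexx ?orbT.
- move=> r s x rs [a [b [Ka Kb -> ar br]]]; exists a, b; split => //.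
  + exact: le_trans rs.
  + exact: le_trans rs.
- move=> r s _ _ [a [b [Ka Kb -> ar br]]] [c [d [Kc Kd -> cs ds]]].
  exists (a + c), (b + d); split; rewrite ?opprD 1?addrACA //.
  + exact: coneD.
  + exact: coneD.
  + exact: le_trans (ler_normD _ _) (lerD ar cs).
  + exact: le_trans (ler_normD _ _) (lerD br ds).
- move=> r l _ [a [b [Ka Kb -> ar br]]]; have [l0|l0] := leP 0 l.
    exists (l *: a), (l *: b); rewrite scalerBr !normrZ (ger0_norm l0).
    by split=> //; rewrite ?ler_wpM2l //; exact: coneZ.
  exists (- l *: b), (- l *: a); rewrite scalerBr !normrZ !scaleNr opprK addrC.
  rewrite -!scaleNr normrN (ltr0_norm l0).
  by split=> //; rewrite ?ler_wpM2l ?oppr_ge0 ?(ltW l0) //;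
    apply: coneZ; rewrite // oppr_ge0 ltW.
- move=> C u x uC ux.
  have [a aP] := choice uC; have [b bP] := choice aP.
  have [n|a' aa' a'C] := geometric_half_series_cvg (u := a) (C := C).
    by have [] := bP n.
  have [n|b' bb' b'C] := geometric_half_series_cvg (u := b) (C := C).
    by have [] := bP n.
  exists a', b'; split => //.
  + by apply: (@cone_series a) => // n; have [] := bP n.
  + by apply: (@cone_series b) => // n; have [] := bP n.
  + apply: (cvg_unique _ ux) => //.
    have -> : series u = series a - series b.
      apply/funext => n; rewrite fctE /series /= -sumrB; apply: eq_bigr => k _.
      by have [] := bP k.
    exact: cvgB.
Qed.

(** The solution is the sum of the [V^n y]: its partial sums satisfy [s (n+1) = y + V (s n)], and
    the limit of this identity is the equation. Positivity passes to the sum since [K] is closed. *)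
Lemma neumann_surj (V : {linear X -> X}) (q : R) y :
  0 <= q -> q < 1 -> (forall x, `|V x| <= q * `|x|) ->
  exists2 x, x - V x = y & (positive_op K V -> K y -> K x).
Proof.
move=> q0 q1 Vq; have cV := linear_bound_continuous Vq.
pose u n := iter n V y.
have uq n : `|u n| <= `|y| * q ^+ n.
  elim: n => [|n IH]; first by rewrite expr0 mulr1.
  rewrite exprS mulrCA; apply: le_trans (Vq _) _.
  by rewrite ler_wpM2l.
have [x ux _] := geometric_series_cvg q0 q1 uq.
exists x; last first.
  move=> pV Ky; apply: (cone_series _ ux) => n.
  by elim: n => //= n; exact: pV.
have := cvg_linear_series cV ux; have -> : V \o u = (fun n => u n.+1).
  by apply/funext.
move=> Vux; apply/eqP; rewrite subr_eq; apply/eqP.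
apply: (cvg_unique _ (_ : (series u \o S) @ \oo --> x)) => //.
  by rewrite -(cvg_shiftS (series u)) in ux.
have -> : series u \o S = (fun n => y + series (fun n => u n.+1) n).
  by apply/funext => n; rewrite /series /= big_nat_recl.
by apply: cvgD => //; exact: cvg_cst.
Qed.
End cone.

(** * Sublinear functions and the Hahn-Banach theorem *)

Definition sublinear (R : realType) (X : lmodType R) (q : X -> R) :=
  (forall x y, q (x + y) <= q x + q y) /\
  (forall a x, 0 <= a -> q (a *: x) = a * q x).

Section hahn_banach.
Variables (R : realType) (X : lmodType R).
Implicit Types p q : X -> R.

Lemma sublinear0 q : sublinear q -> q 0 = 0.
Proof. by case=> _ /(_ 0 0 (lexx 0)); rewrite scale0r mul0r. Qed.

Lemma sublinear_ge q x : sublinear q -> - q (- x) <= q x.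
Proof.
move=> sq; have [qD _] := sq; have := qD x (- x).
by rewrite subrr sublinear0 //; lra.
Qed.

(* The members [f i] need not be sublinear themselves. *)
Lemma sublinear_inf (I : Type) (A : set I) (f : I -> X -> R) (b : X -> R) :
  A !=set0 -> (forall i x, A i -> b x <= f i x) ->
  (forall i j x y, A i -> A j -> exists2 k, A k & f k (x + y) <= f i x + f j y) ->
  (forall (a : R) i x, 0 < a -> A i -> exists2 k, A k & f k (a *: x) <= a * f i x) ->
  inf [set f i 0 | i in A] = 0 ->
  let q x := inf [set f i x | i in A] in
  sublinear q /\ forall i x, A i -> q x <= f i x.
Proof.
move=> [i0 Ai0] fb fD fZ q00 q.
have lbf x : has_lbound [set f i x | i in A].
  by exists (b x) => _ [i Ai <-]; exact: fb.
have qf i x : A i -> q x <= f i x by move=> Ai; apply: ge_inf => //; exists i.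
have qZle (a : R) x : 0 < a -> q (a *: x) <= a * q x.
  move=> a0; rewrite -ler_pdivrMl //.
  apply: lb_le_inf; first by exists (f i0 x), i0.
  move=> _ [i Ai <-]; rewrite ler_pdivrMl //.
  by have [k Ak] := fZ a i x a0 Ai; apply: le_trans; exact: qf.
split=> //; split=> [x y|a x].
  rewrite -lerBlDr; apply: lb_le_inf; first by exists (f i0 x), i0.
  move=> _ [i Ai <-]; rewrite lerBlDr [leRHS]addrC -lerBlDr.
  apply: lb_le_inf; first by exists (f i0 y), i0.
  move=> _ [j Aj <-]; rewrite lerBlDr [leRHS]addrC.
  by have [k Ak] := fD i j x y Ai Aj; apply: le_trans; exact: qf.
rewrite le_eqVlt => /predU1P[<-|a0]; first by rewrite scale0r mul0r.
apply/eqP; rewrite eq_le qZle //= -ler_pdivlMl //.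
rewrite -{1}[x](scalerK (lt0r_neq0 a0)).
by apply: qZle; rewrite invr_gt0.
Qed.

(** Take for [q' x] the infimum of [q (x + t v) - t q v] over [t >= 0]. The choice [t = 0] gives
    [q' <= q]; the choice [t = 1] at [- v] gives the last bound. *)
Lemma sublinear_lower q v : sublinear q ->
  exists q', [/\ sublinear q', (forall x, q' x <= q x) & q' (- v) <= - q v].
Proof.
move=> sq; have [qD qZ] := sq.
pose f t x := q (x + t *: v) - t * q v.
have fb t x : 0 <= t -> - q (- x) <= f t x.
  move=> t0; have := qD (x + t *: v) (- x).
  by rewrite addrAC subrr add0r qZ // /f; lra.
have [|||||sq' q'f] := @sublinear_inf R [set t | 0 <= t] f (fun x => - q (- x)).
- by exists 0 => /=.
- by move=> t x /=; exact: fb.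
- move=> s t x y /= s0 t0; exists (s + t); first exact: addr_ge0.
  have := qD (x + s *: v) (y + t *: v).
  rewrite /f addrACA -scalerDl mulrDl; lra.
- move=> a t x a0 /= t0; exists (a * t); first by rewrite mulr_ge0 // ltW.
  by rewrite /f -scalerA -scalerDr qZ ?(ltW a0) // mulrBr mulrA.
- have -> : [set f t 0 | t in [set t | 0 <= t]] = [set 0].
    apply/seteqP; split=> [_ [t /= t0 <-]|_ ->] /=.
      by rewrite /f add0r qZ // subrr.
    by exists 0; rewrite /= // /f scale0r addr0 sublinear0 // mul0r subrr.
  exact: inf1.
eexists; split; [exact: sq' | move=> x | ].
  by have := q'f 0 x (lexx _); rewrite /f scale0r addr0 mul0r subr0.
have := q'f 1 (- v) ler01; rewrite /f scale1r addNr sublinear0 //.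
by rewrite sub0r mul1r.
Qed.

(* Zorn's lemma gives a minimal sublinear function below [p], and lowering
   shows that a minimal one is odd, hence linear. *)
Lemma hahn_banach p x0 : sublinear p ->
  exists phi : {linear X -> R^o}, (forall x, phi x <= p x) /\ phi x0 = p x0.
Proof.
(* Lowering [p] at [x0] beforehand forces every linear functional below [p0] to take the value
   [p x0] at [x0]. *)
move=> sp; have [p0 [sp0 p0p p0x0]] := sublinear_lower x0 sp.
pose Q := {q : X -> R | sublinear q /\ forall x, q x <= p0 x}.
pose geQ (q1 q2 : Q) := `[< forall x, sval q2 x <= sval q1 x >].
have [|||A totA|[m [sm mp]] mmin] := @Zorn Q geQ.
- by move=> q; apply/asboolP => x.
- move=> q r s /asboolP qr /asboolP rs; apply/asboolP => x.
  exact: le_trans (rs x) (qr x).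
- move=> [q qP] [r rP] /asboolP /= qr /asboolP /= rq; apply: eq_exist.
  by apply/funext => x; apply/eqP; rewrite eq_le qr rq.
(* The empty chain is bounded by [p0], a nonempty one by its pointwise infimum, which is finite
   because each member is at least [- p0 (- x)]. *)
- have [[q0 Aq0]|A0] := pselect (A !=set0); last first.
    exists (exist _ p0 (conj sp0 (fun x => lexx (p0 x)))) => s As.
    by exfalso; apply: A0; exists s.
  have sD (i : Q) : sublinear (sval i) by case: (svalP i).
  have [|||||sq qA] := @sublinear_inf Q A (fun i => sval i) (fun x => - p0 (- x)).
  + by exists q0.
  + move=> i x Ai; have [si ip] := svalP i.
    by apply: le_trans (sublinear_ge x si); rewrite lerN2.
  + move=> i j x y Ai Aj; have [/asboolP ij|/asboolP ji] := totA i j Ai Aj.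
      exists j => //; apply: le_trans ((sD j).1 x y) _; rewrite lerD2r; exact: ij.
    exists i => //; apply: le_trans ((sD i).1 x y) _; rewrite lerD2l; exact: ji.
  + by move=> a i x a0 Ai; exists i => //; rewrite (sD i).2 // ltW.
  + have -> : [set sval i 0 | i in A] = [set 0].
      apply/seteqP; split=> [_ [i Ai <-]|_ ->] /=; first exact: sublinear0.
      by exists q0 => //; exact: sublinear0.
    exact: inf1.
  have qp x : inf [set sval i x | i in A] <= p0 x.
    by apply: le_trans (qA _ x Aq0) _; have [_] := svalP q0.
  exists (exist _ (fun x => inf [set sval i x | i in A]) (conj sq qp)) => s As; apply/asboolP => x /=.
  exact: qA.
have modd v : m (- v) = - m v.
  have [q' [sq' q'm q'v]] := sublinear_lower v sm.
  have q'p x : q' x <= p0 x := le_trans (q'm x) (mp x).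
  have /(_ _)/(congr1 sval)/= q'E := mmin (exist _ q' (conj sq' q'p)).
  have {}q'E : q' = m by apply: q'E; apply/asboolP.
  apply/eqP; rewrite eq_le -{1}q'E q'v /=.
  by have := sublinear_ge (- v) sm; rewrite opprK.
have mD x y : m (x + y) = m x + m y.
  apply/eqP; rewrite eq_le sm.1 /=.
  have := sm.1 (x + y) (- y); rewrite addrK modd; lra.
have mZ a x : m (a *: x) = a * m x.
  have [a0|a0] := leP 0 a; first exact: sm.2.
  by rewrite -[X in X *: _]opprK scaleNr modd sm.2 ?oppr_ge0 ?(ltW a0) // mulNr opprK.
have ml : linear (m : X -> R^o) by move=> a x y; rewrite mD mZ.
pose phi : {linear X -> R^o} :=
  HB.pack (m : X -> R^o) (GRing.isLinear.Build _ _ _ _ _ ml).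
exists phi; have mpp x : m x <= p x := le_trans (mp x) (p0p x).
split => //; apply/eqP; rewrite eq_le /= mpp /=.
by rewrite -lerN2 -modd; apply: le_trans (mp _) p0x0.
Qed.
End hahn_banach.

(** * Positive invertibility of [id - mu T] *)

Definition pos_invertible (R : realType) (X : completeNormedModType R)
    (K : set X) (F : X -> X) :=
  exists g, [/\ cancel F g, cancel g F & positive_op K g].

Section shift.
Variables (R : realType) (X : completeNormedModType R) (T : {linear X -> X}).

Definition shift (mu : R) (x : X) := x - mu *: T x.

Lemma shift_is_linear mu : linear (shift mu).
Proof.
move=> a x y; rewrite /shift linearP scalerDr opprD addrACA; congr (_ + _).
by rewrite scalerBr; congr (_ - _); rewrite !scalerA mulrC.
Qed.

HB.instance Definition _ mu :=
  GRing.isLinear.Build R X X _ (shift mu) (shift_is_linear mu).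

Lemma shiftD mu d x : shift (mu + d) x = shift mu x - d *: T x.
Proof. by rewrite /shift scalerDl opprD addrA. Qed.

Hypothesis cT : continuous T.

Lemma shift_continuous mu : continuous (shift mu).
Proof.
by move=> x; apply: cvgB; [exact: cvg_id | apply: cvgZr; exact: cT].
Qed.
End shift.

Section positive_shift.
Variables (R : realType) (X : completeNormedModType R) (K : set X).
Variable T : {linear X -> X}.
Hypotheses (coneK : is_cone K) (cT : continuous T) (pT : positive_op K T).

(** With [V = d g T] one has [id - (mu + d) T = (id - mu T) (id - V)], where [V] is positive with
    norm at most [d B t < 1], so that its Neumann series applies. *)
Lemma pos_invertible_step (mu d B t : R) (g : X -> X) :
  cancel (shift T mu) g -> cancel g (shift T mu) -> positive_op K g ->
  0 <= B -> (forall x, `|g x| <= B * `|x|) ->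
  0 <= t -> (forall x, `|T x| <= t * `|x|) ->
  0 <= d -> d * (B * t) < 1 -> pos_invertible K (shift T (mu + d)).
Proof.
move=> Fg gF pg B0 gB t0 Tt d0 dBt.
have lg := can2_linear Fg gF.
pose V x := d *: g (T x).
have lV : linear V.
  move=> a x y; rewrite /V [T _]linearP /= lg scalerDr; congr (_ + _).
  by rewrite /= !scalerA mulrC.
pose Vl : {linear X -> X} := HB.pack V (GRing.isLinear.Build _ _ _ _ _ lV).
have Vq x : `|Vl x| <= d * (B * t) * `|x|.
  rewrite /= /V normrZ ger0_norm // -mulrA ler_wpM2l // -mulrA.
  by apply: le_trans (gB _) _; rewrite ler_wpM2l.
have pV : positive_op K Vl.
  by move=> x Kx; apply: coneZ => //; apply: pg; exact: pT.
have FV x : shift T mu (V x) = d *: T x.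
  by rewrite /V linearZ /= gF.
have inj : injective (shift T (mu + d)).
  apply: raddf_inj => x /=; rewrite shiftD => /eqP; rewrite subr_eq0 => /eqP FT.
  have xV : x = V x by rewrite -{1}[x]Fg FT -FV Fg.
  have : `|x| <= d * (B * t) * `|x| by rewrite {1}xV; exact: Vq.
  rewrite -subr_ge0 -[X in _ - X]mul1r -mulrBl => h.
  apply/eqP; rewrite -normr_le0; move: h; rewrite nmulr_rge0 //.
  by rewrite subr_lt0.
have q0 : 0 <= d * (B * t) by rewrite !mulr_ge0.
have /choice[h hP] : forall y, exists x, shift T (mu + d) x = y /\ (K y -> K x).
  move=> y; have [x xE xK] := neumann_surj coneK (g y) q0 dBt Vq.
  exists x; split; last by move=> Ky; apply: xK => //; exact: pg.
  move/(congr1 (shift T mu)): xE; rewrite gF linearB /= FV => <-.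
  by rewrite shiftD.
have hK : cancel h (shift T (mu + d)) by move=> y; have [] := hP y.
exists h; split => //; first by move=> x; apply: inj; rewrite hK.
by move=> y Ky; have [_] := hP y; exact.
Qed.

(** Let [S] be the set of good parameters in [[0, 1]]. The bound [B] near [sup S] provides a step
    length [d] that does not depend on [mu]; a step from a point of [S] close enough to [sup S]
    either reaches 1 or passes beyond [sup S]. *)
Lemma pos_invertible_continuation :
  (forall s, 0 <= s <= 1 -> exists e B : R, [/\ 0 < e, 0 < B &
     forall mu g, 0 <= mu <= 1 -> `|mu - s| < e ->
       cancel (shift T mu) g -> cancel g (shift T mu) -> positive_op K g ->
       forall x, `|g x| <= B * `|x|]) ->
  pos_invertible K (shift T 1).
Proof.
move=> bnd; have [t t0 Tt] := continuous_linear_bound cT.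
pose S := [set mu : R | 0 <= mu <= 1 /\ pos_invertible K (shift T mu)].
have S0 : S 0.
  split; first by rewrite lexx ler01.
  by exists id; split => // x; rewrite /shift scale0r subr0.
have supS : has_sup S by split; [exists 0 | exists 1 => mu [/andP[]]].
have Ss mu : S mu -> mu <= sup S by exact: sup_upper_bound.
have s01 : 0 <= sup S <= 1.
  rewrite (Ss _ S0) /=; apply: ge_sup; first by exists 0.
  by move=> mu [/andP[]].
have [e [B [e0 B0 eB]]] := bnd _ s01.
have Bt0 : 0 < B * t by exact: mulr_gt0.
pose d := (B * t + 1)^-1; have d0 : 0 < d by rewrite invr_gt0; lra.
have dBt : d * (B * t) < 1 by rewrite mulrC ltr_pdivrMr; lra.
(* Within [e] of the supremum the bound [B] is available; within [d] of it the step overshoots. *)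
have [|mu [mu01 [g [Fg gF pg]]] muS] := @sup_adherent _ S (Num.min e d) _ supS.
  by rewrite lt_min e0.
have gB : forall x, `|g x| <= B * `|x|.
  apply: (eB mu) => //.
  have mus : mu <= sup S by apply: Ss; split=> //; exists g.
  rewrite ler0_norm ?subr_le0 // opprB ltrBlDr -ltrBlDl.
  by apply: le_lt_trans muS; rewrite lerD2l lerN2 ge_min lexx.
have step d' : 0 <= d' <= d -> pos_invertible K (shift T (mu + d')).
  move=> /andP[d'0 d'd].
  apply: (pos_invertible_step Fg gF pg (ltW B0) gB (ltW t0) Tt d'0).
  by apply: le_lt_trans dBt; rewrite ler_wpM2r // ltW.
have [mud|mud] := leP 1 (mu + d).
  have -> : 1 = mu + (1 - mu) by ring.
  by apply: step; case/andP: mu01 => *; apply/andP; split; lra.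
have : mu + d <= sup S.
  apply: Ss; split; last by apply: step; rewrite lexx ltW.
  by case/andP: mu01 => *; apply/andP; split; lra.
suff : sup S - d < mu by lra.
by apply: le_lt_trans muS; rewrite lerD2l lerN2 ge_min lexx orbT.
Qed.

Hypotheses (genK : generating K) (normK : normal_cone K).

(* Since [x - T x <= x - mu *: T x] for [x] in [K] and [mu <= 1], the constant of
   the monotone bounded invertibility property of [T] also serves [mu *: T]. *)
Lemma mbi_pos_invertible (c : R) : 0 <= c ->
  (forall x y, K x -> K y -> cone_le K (x - T x) y -> `|x| <= c * `|y|) ->
  pos_invertible K (shift T 1).
Proof.
move=> c0 mbi; have [M M0 dec] := generating_bound coneK genK.
(* The bound is uniform in [mu], so the radius 1 is arbitrary. Splitting [x = a - b] gives [2 c M],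
   and the summand 1 makes the constant positive. *)
apply: pos_invertible_continuation => s _; exists 1, (2 * c * M + 1).
split=> [//||mu g /andP[mu0 mu1] _ Fg gF pg x].
  by rewrite ltr_wpDl // !mulr_ge0 // ltW.
have gc a : K a -> `|g a| <= c * `|a|.
  move=> Ka; apply: mbi => //; first exact: pg.
  rewrite /cone_le -{1}[a]gF /shift opprB addrC addrA subrK.
  rewrite -[X in X - _]scale1r -scalerBl.
  by apply: coneZ; rewrite ?subr_ge0 //; apply: pT; exact: pg.
have lg := can2_linear Fg gF.
pose gl : {linear X -> X} := HB.pack g (GRing.isLinear.Build _ _ _ _ _ lg).
have [a [b [Ka Kb xE ax bx]]] := dec x.
have -> : g x = g a - g b by rewrite xE; exact: (linearB gl).
apply: le_trans (ler_normB _ _) _.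
have := gc _ Ka; have := gc _ Kb.
have : c * `|a| <= c * (M * `|x|) by rewrite ler_wpM2l.
have : c * `|b| <= c * (M * `|x|) by rewrite ler_wpM2l.
have := normr_ge0 x; rewrite mulrDl mul1r -!mulrA; lra.
Qed.

(* Near [s] the inverses of [id - mu T] are bounded by twice the norm of the
   inverse of [id - s T]. *)
Lemma bijective_shifts_pos_invertible :
  (forall s, 0 <= s <= 1 -> bijective (shift T s)) ->
  pos_invertible K (shift T 1).
Proof.
move=> bij; have [t t0 Tt] := continuous_linear_bound cT.
apply: pos_invertible_continuation => s /bij[h Fh hF].
have [B B0 hB] := bounded_inverse (shift_continuous cT (mu := s)) Fh hF.
have Bt0 : 0 < B * t by exact: mulr_gt0.
(* For such [mu] the term [(mu - s) T x] contributes at most [|x| / 2] to [x = h (y + (mu - s) T x)]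
   and is absorbed on the left. *)
exists (2 * (B * t))^-1, (2 * B); split; rewrite ?invr_gt0 ?mulr_gt0 //.
move=> mu g _ mus Fg gF _ y; set x := g y.
have xE : x = h (y + (mu - s) *: T x).
  by rewrite -{1}[y]gF -/x -[in shift T mu _](subrKC s mu) shiftD subrK Fh.
have : `|x| <= B * (`|y| + `|mu - s| * (t * `|x|)).
  rewrite {1}xE; apply: le_trans (hB _) _; rewrite ler_wpM2l ?(ltW B0) //.
  apply: le_trans (ler_normD _ _) _; rewrite lerD2l normrZ ler_wpM2l //.
have : `|mu - s| * (2 * (B * t)) * `|x| <= 1 * `|x|.
  by rewrite ler_wpM2r // -ler_pdivlMr ?mulr_gt0 // mul1r ltW.
rewrite !mulrDr; lra.
Qed.

Lemma pos_invertible_power_decay : pos_invertible K (shift T 1) ->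
  exists C q : R, [/\ 0 < q, q < 1 &
    forall n x, `|iter n T x| <= C * q ^+ n * `|x|].
Proof.
move=> [g [Fg gF pg]]; have [t t0 Tt] := continuous_linear_bound cT.
have [B B0 gB] := bounded_inverse (shift_continuous cT (mu := 1)) Fg gF.
have Bt0 : 0 < B * t by exact: mulr_gt0.
pose d := (B * t + 1)^-1; have d0 : 0 < d by rewrite invr_gt0; lra.
have dBt : d * (B * t) < 1 by rewrite mulrC ltr_pdivrMr; lra.
have := pos_invertible_step Fg gF pg (ltW B0) gB (ltW t0) Tt (ltW d0) dBt.
set mu := 1 + d; have mu1 : 1 < mu by rewrite /mu; lra.
have mu0 : 0 < mu by lra.
move=> [h [Fh hF ph]].
have [B' B'0 hB'] := bounded_inverse (shift_continuous cT (mu := mu)) Fh hF.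
have [N [N0 normN]] := normK.
have [M M0 dec] := generating_bound coneK genK.
have hE x : h x = x + mu *: T (h x) by rewrite -{2}[x]hF /shift subrK.
have itK n x : K x -> K (iter n T x) by move=> Kx; elim: n => //= n /pT.
(* Induction from [h = id + mu T h]: the difference at [n + 1] is [x] plus [mu T] of the difference
   at [n]. *)
have le_h n x : K x -> K (h x - mu ^+ n *: iter n T x).
  move=> Kx; elim: n => [|n IH].
    rewrite expr0 scale1r {1}hE /= addrAC subrr add0r.
    by apply: coneZ => //; [exact: ltW | apply: pT; exact: ph].
  rewrite {1}hE exprS -scalerA -addrA -scalerBr /=.
  rewrite -linearZ -linearB /=; apply: coneD => //.
  by apply: coneZ => //; [exact: ltW | exact: pT].
have decK n x : K x -> mu ^+ n * `|iter n T x| <= N * B' * `|x|.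
  move=> Kx; rewrite -[X in X * _](gtr0_norm (exprn_gt0 n mu0)) -normrZ.
  have : `|mu ^+ n *: iter n T x| <= N * `|h x|.
    apply: normN; rewrite /cone_le ?subr0; last exact: le_h.
    by apply: coneZ => //; [rewrite exprn_ge0 // ltW | exact: itK].
  by move/le_trans; apply; rewrite -mulrA ler_wpM2l // ltW.
(* [N] comes from normality, [B'] bounds [h], [M] bounds the parts of [x = a - b], and 2 counts
   these parts. *)
exists (2 * (N * B' * M)), mu^-1.
have NB0 : 0 < N * B' by exact: mulr_gt0.
split; rewrite ?invr_gt0 ?invf_lt1 //.
move=> n x; have [a [b [Ka Kb xE ax bx]]] := dec x.
have -> : iter n T x = iter n T a - iter n T b.
  by rewrite xE; elim: n {le_h decK itK} => //= n ->; rewrite linearB.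
rewrite exprVn mulrAC ler_pdivlMr ?exprn_gt0 // mulrC.
have : mu ^+ n * `|iter n T a - iter n T b| <=
    mu ^+ n * `|iter n T a| + mu ^+ n * `|iter n T b|.
  by rewrite -mulrDr ler_wpM2l ?ler_normB // exprn_ge0 // ltW.
have := decK n _ Ka; have := decK n _ Kb.
have : N * B' * `|a| <= N * B' * (M * `|x|) by rewrite ler_pM2l.
have : N * B' * `|b| <= N * B' * (M * `|x|) by rewrite ler_pM2l.
rewrite -!mulrA; lra.
Qed.

(** Applying the positive inverse to [x - T x <= y] gives [x <= g y]; normality turns this into a
    norm bound. *)
Lemma pos_invertible_mbi : pos_invertible K (shift T 1) ->
  exists c : R, 0 <= c /\
    forall x y, K x -> K y -> cone_le K (x - T x) y -> `|x| <= c * `|y|.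
Proof.
move=> [g [Fg gF pg]].
have [B B0 gB] := bounded_inverse (shift_continuous cT (mu := 1)) Fg gF.
have [N [N0 normN]] := normK.
have lg := can2_linear Fg gF.
pose gl : {linear X -> X} := HB.pack g (GRing.isLinear.Build _ _ _ _ _ lg).
exists (N * B); split=> [|x y Kx Ky /pg]; first by rewrite mulr_ge0 // ltW.
have -> : g (y - (x - T x)) = g y - x.
  have -> : g (y - (x - T x)) = g y - g (x - T x) by exact: (linearB gl).
  by rewrite -[T x]scale1r Fg.
move=> xgy; have : `|x| <= N * `|g y|.
  by apply: normN; rewrite // /cone_le subr0.
by move/le_trans; apply; rewrite -mulrA ler_wpM2l // ltW.
Qed.

(** For [y] in [K] and [z = T x - x - y], split [- z = a - b]. Then [x - T x = a - b - y <= a],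
    whence [|x| <= c |a| <= c M |z|]. *)
Lemma mbi_uniform_small_gain (c : R) : 0 <= c ->
  (forall x y, K x -> K y -> cone_le K (x - T x) y -> `|x| <= c * `|y|) ->
  exists eta : R, 0 < eta /\
    forall x, K x -> eta * `|x| <= dist_set (T x - x) K.
Proof.
move=> c0 mbi; have [M M0 dec] := generating_bound coneK genK.
have cM0 : 0 < c * M + 1 by rewrite ltr_wpDl // mulr_ge0 // ltW.
exists (c * M + 1)^-1; split=> [|x Kx]; first by rewrite invr_gt0.
apply: lb_le_inf.
  by exists `|T x - x - 0|, 0 => //; exact: cone0.
move=> _ [y Ky <-]; set z := T x - x - y.
have [a [b [Ka Kb zE az bz]]] := dec (- z).
rewrite normrN in az.
have : `|x| <= c * `|a|.
  apply: mbi => //; rewrite /cone_le.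
  suff -> : a - (x - T x) = y + b by exact: coneD.
  have -> : a = b - z by rewrite zE addrC subrK.
  by rewrite [- (x - _)]opprB /z [- (_ - y)]opprB -addrA subrK addrC.
have : c * `|a| <= c * (M * `|z|) by rewrite ler_wpM2l.
rewrite ler_pdivrMl //; have := normr_ge0 z; lra.
Qed.

(** If [x <= T x + P x], then [T x + P x - x] is a point of [K] at distance [|P x|] from [T x - x],
    so [eta |x| <= |P x| <= (eta / 2) |x|]. *)
Lemma uniform_robust_small_gain (eta : R) : 0 < eta ->
  (forall x, K x -> eta * `|x| <= dist_set (T x - x) K) ->
  exists eps : R, 0 < eps /\
    forall (P : {linear X -> X}) (x : X), continuous P -> positive_op K P ->
      opnorm_le P eps -> K x -> x != 0 -> ~ cone_le K x (T x + P x).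
Proof.
move=> eta0 usg; exists (eta / 2); split=> [|P x _ _ Pe Kx x0 xTP].
  exact: divr_gt0.
have : dist_set (T x - x) K <= `|P x|.
  apply: ge_inf; first by exists 0 => _ [y _ <-].
  exists (T x + P x - x) => //.
  by rewrite -normrN opprB [T x + _ - x]addrAC [X in `|X| = _]addrC addKr.
have := usg x Kx; have := Pe x.
have : 0 < eta * `|x| by rewrite mulr_gt0 // normr_gt0.
lra.
Qed.
End positive_shift.

(** * The Neumann series on the complexification *)

Section resolvent.
Variables (R : realType) (X : completeNormedModType R) (T : {linear X -> X}).
Variables (a b : R).
Hypothesis ab0 : 0 < a ^+ 2 + b ^+ 2.

(* Real and imaginary part of [(a + i b)^-n]. *)
Let rho := a ^+ 2 + b ^+ 2.
Fixpoint inv_pow (n : nat) : R * R :=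
  if n is n'.+1 then
    let z := inv_pow n' in
    ((a * z.1 + b * z.2) / rho, (a * z.2 - b * z.1) / rho)
  else (1, 0).

Lemma inv_powSK n :
  a * (inv_pow n.+1).1 - b * (inv_pow n.+1).2 = (inv_pow n).1 /\
  a * (inv_pow n.+1).2 + b * (inv_pow n.+1).1 = (inv_pow n).2.
Proof. by rewrite /=; split; rewrite /rho; field; rewrite gt_eqF. Qed.

Lemma inv_pow_normsq n : (inv_pow n).1 ^+ 2 + (inv_pow n).2 ^+ 2 = rho ^- n.
Proof.
elim: n => [|n IH] /=; first by rewrite expr0 invr1; ring.
by rewrite [rho ^+ _]exprS invfM -IH /rho; field; rewrite gt_eqF.
Qed.

Lemma inv_pow_le n : `|(inv_pow n).1| <= (Num.sqrt rho)^-1 ^+ n /\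
  `|(inv_pow n).2| <= (Num.sqrt rho)^-1 ^+ n.
Proof.
have r0 : 0 <= (Num.sqrt rho)^-1 ^+ n by rewrite exprn_ge0 // invr_ge0.
have E : ((Num.sqrt rho)^-1 ^+ n) ^+ 2 = rho ^- n.
  by rewrite -exprM mulnC exprM exprVn sqr_sqrtr ?exprVn // ltW.
have := inv_pow_normsq n; rewrite -E.
by split; rewrite -(@ler_pXn2r _ 2) ?nnegrE // real_normK ?num_real //;
  have := sqr_ge0 (inv_pow n).1; have := sqr_ge0 (inv_pow n).2; lra.
Qed.

Variables (C q : R).
Hypotheses (cT : continuous T) (q0 : 0 <= q) (qab : q < Num.sqrt rho).
Hypothesis decay : forall n x, `|iter n T x| <= C * q ^+ n * `|x|.

(* [w1 + i w2] is [(a + i b)^-n T^n (x + i y)]. *)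
Let w1 n x y := (inv_pow n).1 *: iter n T x - (inv_pow n).2 *: iter n T y.
Let w2 n x y := (inv_pow n).2 *: iter n T x + (inv_pow n).1 *: iter n T y.

Let ratio := q / Num.sqrt rho.

Let sqrt_gt0 : 0 < Num.sqrt rho. Proof. by rewrite sqrtr_gt0. Qed.

Let ratio_ge0 : 0 <= ratio. Proof. by rewrite divr_ge0 // ltW. Qed.

Let ratio_lt1 : ratio < 1. Proof. by rewrite ltr_pdivrMr // mul1r. Qed.

Lemma inv_pow_iter_le c n x : `|c| <= (Num.sqrt rho)^-1 ^+ n ->
  `|c *: iter n T x| <= C * `|x| * ratio ^+ n.
Proof.
move=> cle; rewrite normrZ.
have := ler_pM (normr_ge0 _) (normr_ge0 _) cle (decay n x).
by move/le_trans; apply; rewrite /ratio exprMn; rewrite le_eqVlt; apply/orP; left;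
  apply/eqP; ring.
Qed.

Lemma inv_pow_iter_re_le n x y : `|w1 n x y| <= (C * (`|x| + `|y|)) * ratio ^+ n.
Proof.
apply: le_trans (ler_normB _ _) _; rewrite mulrDr mulrDl.
by have [? ?] := inv_pow_le n; apply: lerD; exact: inv_pow_iter_le.
Qed.

Lemma inv_pow_iter_im_le n x y : `|w2 n x y| <= (C * (`|x| + `|y|)) * ratio ^+ n.
Proof.
apply: le_trans (ler_normD _ _) _; rewrite mulrDr mulrDl.
by have [? ?] := inv_pow_le n; apply: lerD; exact: inv_pow_iter_le.
Qed.

Lemma iter_linearD n x y c d :
  iter n T (c *: x + d *: y) = c *: iter n T x + d *: iter n T y.
Proof. by elim: n => //= n ->; rewrite linearD !linearZ. Qed.

(** This and the next lemma are the real and imaginary parts of [T w_n = (a + i b) w_(n+1)]. *)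
Lemma inv_pow_iter_reS n x y : T (w1 n x y) = a *: w1 n.+1 x y - b *: w2 n.+1 x y.
Proof.
rewrite /w1 /w2 [T _]linearB; have [<- <-] := inv_powSK n.
move: (inv_pow n.+1) => [c d] /=; rewrite ![T (_ *: _)]linearZ /=.
rewrite !scalerBr !scalerDr !scalerA opprD addrACA -scalerBl.
by rewrite -opprD -scalerDl.
Qed.

Lemma inv_pow_iter_imS n x y : T (w2 n x y) = b *: w1 n.+1 x y + a *: w2 n.+1 x y.
Proof.
rewrite /w1 /w2 [T _]linearD; have [<- <-] := inv_powSK n.
move: (inv_pow n.+1) => [c d] /=; rewrite ![T (_ *: _)]linearZ /=.
rewrite !scalerBr !scalerDr !scalerA addrACA -scalerDl [a * _ + _]addrC.
by rewrite [- _ + _]addrC -scalerBl.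
Qed.

Lemma complexified_shift_inj : injective (complexified_shift T a b).
Proof.
have key x y : T x - a *: x + b *: y = 0 -> T y - b *: x - a *: y = 0 ->
    x = 0 /\ y = 0.
  move=> hx hy.
  have Tx : T x = a *: x - b *: y.
    by apply/eqP; rewrite -subr_eq0 opprB addrA addrAC; apply/eqP.
  have Ty : T y = b *: x + a *: y.
    by apply/eqP; rewrite -subr_eq0 opprD addrA; apply/eqP.
  (* A kernel vector is an eigenvector for [a + i b], so the sequence [w_n] is constant, while it
     also decays geometrically. *)
  have wE n : w1 n x y = x /\ w2 n x y = y.
    elim: n => [|n [IH1 IH2]]; rewrite /w1 /w2.
      by rewrite /= !scale0r !scale1r subr0 add0r.
    have [c1 c2] := inv_powSK n.
    rewrite !iterSr Tx Ty -scaleNr !iter_linearD; move: IH1 IH2.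
    rewrite /w1 /w2 -c1 -c2; set X' := iter _ _ x; set Y' := iter _ _ y.
    move: (inv_pow n.+1).1 (inv_pow n.+1).2 => c d <- <-.
    rewrite !scalerDr !scalerA; split.
      rewrite opprD addrACA -[- (_ *: X')]scaleNr -![- (_ *: Y')]scaleNr.
      rewrite -!scalerDl.
      by congr (_ *: _ + _ *: _); ring.
    by rewrite addrACA -!scalerDl; congr (_ *: _ + _ *: _); ring.
  have zero (u : X) D : (forall n, `|u| <= D * ratio ^+ n) -> u = 0.
    move=> uD; have [l ul _] :=
      geometric_series_cvg (u := fun=> u) ratio_ge0 ratio_lt1 uD.
    have u0 := cvg_series_cvg_0 (cvgP _ ul).
    by apply: (cvg_unique _ (cvg_cst u) u0).
  split; apply: (zero _ (C * (`|x| + `|y|))) => n.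
    by rewrite -{1}(wE n).1; exact: inv_pow_iter_re_le.
  by rewrite -{1}(wE n).2; exact: inv_pow_iter_im_le.
have dif (A1 A2 B1 B2 C1 C2 : X) : (A1 - A2) + (B1 - B2) + (C1 - C2) =
    (A1 + B1 + C1) - (A2 + B2 + C2).
  by rewrite !opprD [RHS]addrACA [A1 + _ + _]addrACA.
move=> [x1 y1] [x2 y2] [h1 h2].
have [||/eqP+ /eqP] := key (x1 - x2) (y1 - y2).
- by rewrite linearB -scaleNr !scalerBr dif !scaleNr h1 subrr.
- by rewrite linearB -!scaleNr !scalerBr dif !scaleNr h2 subrr.
by rewrite !subr_eq0 => /eqP -> /eqP ->.
Qed.

(** Put [l = a + i b], [z = - l^-1 (u + i v)] and let [W] be the sum of the [l^-n T^n z]. Shifting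
    the index gives [T W = l (W - z)], hence [(T - l) W = - l z = u + i v]. *)
Lemma complexified_shift_surj u v :
  exists p, complexified_shift T a b p = (u, v).
Proof.
(* [x + i y] is [- (a + i b)^-1 (u + i v)]. *)
pose x := (- (a / rho)) *: u + (- (b / rho)) *: v.
pose y := (b / rho) *: u + (- (a / rho)) *: v.
have uE : b *: y - a *: x = u.
  rewrite /x /y !scalerDr !scalerA opprD addrACA.
  rewrite -[- (_ *: u)]scaleNr -[- (_ *: v)]scaleNr -!scalerDl.
  rewrite -[RHS]addr0 -[X in _ = X + _]scale1r -[X in _ = _ + X](scale0r v).
  by congr (_ *: _ + _ *: _); rewrite /rho; field; rewrite gt_eqF.
have vE : - (b *: x + a *: y) = v.
  rewrite /x /y !scalerDr !scalerA addrACA -!scalerDl opprD.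
  rewrite -[- (_ *: u)]scaleNr -[- (_ *: v)]scaleNr.
  rewrite -[RHS]add0r -[X in _ = _ + X]scale1r -[X in _ = X + _](scale0r u).
  by congr (_ *: _ + _ *: _); rewrite /rho; field; rewrite gt_eqF.
have [W1 cW1 _] := geometric_series_cvg ratio_ge0 ratio_lt1
  (fun n => inv_pow_iter_re_le n x y).
have [W2 cW2 _] := geometric_series_cvg ratio_ge0 ratio_lt1
  (fun n => inv_pow_iter_im_le n x y).
have tail (w : nat -> X) W : series w @ \oo --> W ->
    series (fun n => w n.+1) @ \oo --> W - w 0%N.
  move=> cW.
  have -> : series (fun n => w n.+1) = (fun n => series w n.+1 - w 0%N).
    by apply/funext => n; rewrite /series /= big_nat_recl // addrC addKr.
  apply: cvgB; last exact: cvg_cst.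
  by rewrite -(cvg_shiftS (series w)) in cW.
have w10 : w1 0 x y = x by rewrite /w1 /= scale1r scale0r subr0.
have w20 : w2 0 x y = y by rewrite /w2 /= scale1r scale0r add0r.
have := tail _ _ cW1; have := tail _ _ cW2; rewrite w10 w20 => cW2' cW1'.
have TW1 : T W1 = a *: (W1 - x) - b *: (W2 - y).
  apply: (cvg_unique _ (cvg_linear_series cT cW1)) => //.
  have -> : series (T \o (fun n => w1 n x y)) = (fun n =>
      a *: series (fun n => w1 n.+1 x y) n - b *: series (fun n => w2 n.+1 x y) n).
    apply/funext => n; rewrite /series /= !scaler_sumr -sumrB.
    by apply: eq_bigr => k _; rewrite inv_pow_iter_reS.
  by apply: cvgB; apply: cvgZr.
have TW2 : T W2 = b *: (W1 - x) + a *: (W2 - y).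
  apply: (cvg_unique _ (cvg_linear_series cT cW2)) => //.
  have -> : series (T \o (fun n => w2 n x y)) = (fun n =>
      b *: series (fun n => w1 n.+1 x y) n + a *: series (fun n => w2 n.+1 x y) n).
    apply/funext => n; rewrite /series /= !scaler_sumr -big_split.
    by apply: eq_bigr => k _; rewrite inv_pow_iter_imS.
  by apply: cvgD; apply: cvgZr.
have cancel1 (A B C' D : X) : A - B - (C' - D) - A + C' = D - B.
  rewrite opprB [_ + _ - A]addrAC [A - B - A]addrAC subrr sub0r.
  by rewrite -addrA subrK addrC.
have cancel2 (A B C' D : X) : A - B + (C' - D) - A - C' = - (B + D).
  rewrite [_ + _ - A]addrAC [A - B - A]addrAC subrr sub0r -addrA.
  by rewrite [C' - D - C']addrAC subrr sub0r opprD.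
exists (W1, W2); rewrite /complexified_shift /= TW1 TW2 -uE -vE !scalerBr.
by rewrite cancel1 cancel2.
Qed.

Lemma complexified_shift_bij : bijective (complexified_shift T a b).
Proof.
rewrite -setTT_bijective; split=> //.
- by move=> x y _ _; exact: complexified_shift_inj.
- by move=> [u v] _; have [p pE] := complexified_shift_surj u v; exists p.
Qed.
End resolvent.

(** * From power decay to the spectral radius, and from the spectral radius to bijectivity *)

Section spectrum.
Variables (R : realType) (X : completeNormedModType R) (T : {linear X -> X}).
Hypothesis cT : continuous T.

Lemma power_decay_spectrum (C q : R) : 0 <= q ->
  (forall n x, `|iter n T x| <= C * q ^+ n * `|x|) ->
  ubound [set Num.sqrt (ab.1 ^+ 2 + ab.2 ^+ 2) | ab in spectrum T] q.
Proof.
move=> q0 decay _ [[a b] /= spec <-]; rewrite leNgt; apply/negP => qab.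
apply: spec => /=; apply: (complexified_shift_bij _ cT q0 qab decay).
by rewrite -sqrtr_gt0; apply: le_lt_trans qab.
Qed.

Lemma power_decay_spectral_radius (C q : R) : 0 <= q -> q < 1 ->
  (forall n x, `|iter n T x| <= C * q ^+ n * `|x|) -> spectral_radius T < 1.
Proof.
move=> q0 q1 /(power_decay_spectrum q0) ubq; rewrite /spectral_radius.
set S := image _ _ in ubq *.
have [S0|/set0P/negP/negPn/eqP ->] := pselect (S !=set0).
  exact: le_lt_trans (ge_sup S0 ubq) q1.
(* The [sup] of the empty set is 0 by convention. *)
by rewrite sup0.
Qed.

(** The trivial bound [|T^n x| <= t^n |x|] counts as power decay. Boundedness ensures that [sup] is
    a genuine upper bound here and not the default value 0. *)
Lemma spectrum_bounded :
  has_ubound [set Num.sqrt (ab.1 ^+ 2 + ab.2 ^+ 2) | ab in spectrum T].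
Proof.
have [t t0 Tt] := continuous_linear_bound cT.
exists t; apply: (@power_decay_spectrum 1 t (ltW t0)) => n x; rewrite mul1r.
elim: n => [|n IH] /=; first by rewrite expr0 mul1r.
by apply: le_trans (Tt _) _; rewrite exprS -mulrA ler_pM2l.
Qed.

(** For [0 < s <= 1] the real number [s^-1] exceeds the spectral radius, and
    [T - s^-1 = - s^-1 (id - s T)]. Since the imaginary part of [s^-1] is 0, the complexified
    operator acts on each component separately, and the inverse restricts to the first one. *)
Lemma spectral_radius_bijective_shift s : spectral_radius T < 1 ->
  0 <= s <= 1 -> bijective (shift T s).
Proof.
move=> r1 /andP[]; rewrite le_eqVlt => /predU1P[<- _|s0 s1].
  by exists id => x; rewrite /shift scale0r subr0.
have : ~ spectrum T (s^-1, 0).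
  move=> sp; suff : s^-1 <= spectral_radius T.
    by apply/negP; rewrite -ltNge (lt_le_trans r1) // invf_ge1.
  apply: ub_le_sup; first exact: spectrum_bounded.
  exists (s^-1, 0) => //=.
  by rewrite expr0n addr0 sqrtr_sqr ger0_norm // invr_ge0 ltW.
move=> /contrapT[G FG GF].
have E x : complexified_shift T s^-1 0 (x, 0) = (- s^-1 *: shift T s x, 0).
  rewrite /complexified_shift /shift /= !scaler0 !scale0r linear0 subr0 !addr0.
  by rewrite subr0 scalerBr scaleNr scalerA mulNr mulVf ?gt_eqF // scaleN1r opprK addrC.
have E2 p : (complexified_shift T s^-1 0 p).1 = - s^-1 *: shift T s p.1.
  rewrite /complexified_shift /shift /= scale0r addr0.
  by rewrite scalerBr scaleNr scalerA mulNr mulVf ?gt_eqF // scaleN1r opprK addrC.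
exists (fun y => (G (- s^-1 *: y, 0)).1) => [x|y]; first by rewrite -E FG.
have := E2 (G (- s^-1 *: y, 0)); rewrite GF /= => /esym/scalerI; apply.
by rewrite oppr_eq0 invr_eq0 gt_eqF.
Qed.
End spectrum.

(** * Positive functionals and rank-one perturbations *)

(* [phi] comes from Hahn-Banach applied to the distance to [- K]; by normality,
   [x] in [K] has distance at least [`|x| / N] from [- K]. *)
Lemma normal_cone_functional (R : realType) (X : completeNormedModType R)
    (K : set X) : is_cone K -> normal_cone K ->
  exists2 N : R, 0 < N & forall x, K x -> exists phi : {linear X -> R^o},
    [/\ forall z, K z -> 0 <= phi z, forall z, `|phi z| <= `|z| & `|x| <= N * phi x].
Proof.
move=> coneK [N [N0 normN]]; exists N => // x Kx.
pose f k (z : X) := `|z + k|.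
have [|||||sp pf] := @sublinear_inf R X X K f (fun=> 0).
- by exists 0; exact: cone0.
- by move=> k z _; exact: normr_ge0.
- move=> k l y z Kk Kl; exists (k + l); first exact: coneD.
  by rewrite /f addrACA ler_normD.
- move=> a k z a0 Kk; exists (a *: k); first by apply: coneZ => //; exact: ltW.
  by rewrite /f -scalerDr normrZ gtr0_norm.
- apply/eqP; rewrite eq_le; apply/andP; split.
    apply: ge_inf; first by exists 0 => _ [k _ <-]; exact: normr_ge0.
    by exists 0; [exact: cone0 | rewrite /f addr0 normr0].
  apply: lb_le_inf; first by exists (f 0 0), 0 => //; exact: cone0.
  by move=> _ [k _ <-]; exact: normr_ge0.
have [phi [phip phix]] := hahn_banach x sp.
have phi_le z k : K k -> phi z <= `|z + k|.
  by move=> Kk; apply: le_trans (phip z) _; exact: pf.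
exists phi; split=> [z Kz|z|].
- have := phi_le (- z) z Kz; rewrite addNr normr0 linearN; lra.
- have := phi_le z 0 (cone0 coneK); have := phi_le (- z) 0 (cone0 coneK).
  rewrite !addr0 normrN linearN => *.
  by rewrite ler_norml; apply/andP; split; lra.
- rewrite phix -ler_pdivrMl //; apply: lb_le_inf.
    by exists (f 0 x), 0 => //; exact: cone0.
  move=> _ [k Kk <-]; rewrite ler_pdivrMl //; apply: normN.
    by rewrite /cone_le subr0.
  by rewrite /cone_le addrAC subrr add0r.
Qed.

Lemma rank_one_small_gain_mbi (R : realType) (X : completeNormedModType R)
    (K : set X) (T : {linear X -> X}) (eps : R) :
  is_cone K -> normal_cone K -> 0 < eps ->
  (forall (P : {linear X -> X}) (x : X), continuous P -> positive_op K P ->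
     rank_one P -> opnorm_le P eps -> K x -> x != 0 ->
     ~ cone_le K x (T x + P x)) ->
  exists c : R, 0 <= c /\
    forall x y, K x -> K y -> cone_le K (x - T x) y -> `|x| <= c * `|y|.
Proof.
move=> coneK normK eps0 sg.
have [N N0 func] := normal_cone_functional coneK normK.
exists (N / eps); split=> [|x y Kx Ky xy]; first by rewrite divr_ge0 // ltW.
have [->|x0] := eqVneq x 0; first by rewrite normr0 mulr_ge0 // divr_ge0 // ltW.
have nx0 : 0 < `|x| by rewrite normr_gt0.
(* Were the bound false, then [|y'| <= eps phi x], so [P] would have norm at most [eps]; and
   [P x = y'] would give [x <= T x + P x]. *)
have main y' : K y' -> y' != 0 -> cone_le K (x - T x) y' ->
    `|x| <= N / eps * `|y'|.
  move=> Ky' y'0 xy'; rewrite leNgt; apply/negP => small.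
  have [phi [phi_ge0 phi_le phix]] := func x Kx.
  have phix0 : 0 < phi x by rewrite -(pmulr_rgt0 _ N0); exact: lt_le_trans phix.
  pose Pf z : X := (phi z / phi x) *: y'.
  have lP : linear Pf.
    by move=> a u v; rewrite /Pf linearP mulrDl scalerDl scalerA mulrA.
  pose P : {linear X -> X} := HB.pack Pf (GRing.isLinear.Build _ _ _ _ _ lP).
  have Pn z : `|P z| <= eps * `|z|.
    rewrite /= /Pf normrZ normrM normfV (gtr0_norm phix0).
    rewrite mulrAC ler_pdivrMr //.
    have h1 : `|y'| <= eps * phi x.
      have := lt_le_trans small phix.
      by rewrite mulrAC -mulrA ltr_pM2l // ltr_pdivrMr // mulrC => /ltW.
    have := ler_pM (normr_ge0 _) (normr_ge0 _) (phi_le z) h1.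
    by move/le_trans; apply; rewrite mulrCA mulrA.
  have PxE : P x = y' by rewrite /= /Pf divff ?gt_eqF // scale1r.
  apply: (sg P x) => //.
  - exact: linear_bound_continuous Pn.
  - move=> z Kz; apply: coneZ => //; rewrite divr_ge0 ?(ltW phix0) //.
    exact: phi_ge0.
  - split; first by exists x; rewrite PxE.
    by exists y' => z; exists (phi z / phi x).
  - rewrite PxE /cone_le; move: xy'; rewrite /cone_le opprB addrA.
    by rewrite [y' + _]addrC.
have [y0|] := eqVneq y 0; last by move=> y0; exact: main.
(* For [y = 0] the previous case applied to small multiples of [x] is absurd. *)
exfalso; pose d := eps / (2 * N); have d0 : 0 < d by rewrite divr_gt0 // mulr_gt0.
have : `|x| <= N / eps * `|d *: x|.
  apply: main; first by apply: coneZ => //; exact: ltW.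
    by rewrite scaler_eq0 (gt_eqF d0).
  rewrite /cone_le -[d *: x]addr0 -y0 -addrA.
  by apply: coneD => //; apply: coneZ => //; exact: ltW.
rewrite normrZ gtr0_norm // mulrA.
have -> : N / eps * d = 2^-1 by rewrite /d; field; rewrite !gt_eqF.
by lra.
Qed.

(** * The equivalences *)

Theorem theorem3p3 (R : realType) (X : completeNormedModType R) (K : set X)
  (T : {linear X -> X}) :
  is_cone K -> generating K -> normal_cone K ->
  continuous T -> positive_op K T ->
  let f := fun x : X => x - T x in
  [/\ (spectral_radius T < 1 <->
       exists g : X -> X, [/\ cancel f g, cancel g f & positive_op K g]),
      (spectral_radius T < 1 <->
       exists c : R, 0 <= c /\
         forall x y : X, K x -> K y -> cone_le K (f x) y -> `|x| <= c * `|y|),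
      (spectral_radius T < 1 <->
       exists eta : R, 0 < eta /\
         forall x : X, K x -> eta * `|x| <= dist_set (T x - x) K),
      (spectral_radius T < 1 <->
       exists eps : R, 0 < eps /\
         forall (P : {linear X -> X}) (x : X), continuous P -> positive_op K P ->
           opnorm_le P eps -> K x -> x != 0 -> ~ cone_le K x (T x + P x))
    & (spectral_radius T < 1 <->
       exists eps : R, 0 < eps /\
         forall (P : {linear X -> X}) (x : X), continuous P -> positive_op K P ->
           rank_one P -> opnorm_le P eps -> K x -> x != 0 ->
           ~ cone_le K x (T x + P x))].
Proof.
move=> coneK genK normK cT pT f.
have fE : f = shift T 1 by apply/funext => x; rewrite /f /shift scale1r.
set S1 := spectral_radius T < 1.
set S2 := exists g : X -> X, _.
set S3 := exists c : R, _.
set S4 := exists eta : R, _.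
set S5 := (X in [/\ _, _, _, _ <-> X & _]).
set S6 := (X in [/\ _, _, _, _ & _ <-> X]).
have h12 : S1 -> S2.
  move=> r1; rewrite /S2 fE; apply: bijective_shifts_pos_invertible => // s.
  exact: spectral_radius_bijective_shift.
have h21 : S2 -> S1.
  rewrite /S2 fE => /(pos_invertible_power_decay coneK cT pT genK normK).
  move=> [C [q [q0 q1 decay]]].
  exact: (power_decay_spectral_radius cT (ltW q0) q1 decay).
have h23 : S2 -> S3 by rewrite /S2 fE => /(pos_invertible_mbi cT normK).
have h32 : S3 -> S2.
  by move=> [c [c0 mbi]]; rewrite /S2 fE; exact: (mbi_pos_invertible coneK cT pT genK c0 mbi).
have h34 : S3 -> S4.
  by move=> [c [c0 mbi]]; exact: (mbi_uniform_small_gain coneK genK c0 mbi).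
have h45 : S4 -> S5.
  by move=> [eta [eta0 usg]]; exact: (uniform_robust_small_gain eta0 usg).
have h56 : S5 -> S6.
  by move=> [eps [eps0 sg]]; exists eps; split=> // P x cP pP _; exact: sg.
have h63 : S6 -> S3.
  by move=> [eps [eps0 sg]]; exact: (rank_one_small_gain_mbi coneK normK eps0 sg).
by split; tauto.
Qed.
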